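(* Let $\varepsilon\in\{-1,0,1\}$. Then for $\alpha>\beta>0$ with $1+\varepsilon\alpha^2>0$ and $1+\varepsilon\beta^2>0$, for $s,\tilde s\in\mathbb{R}$, and $u_0^{\ell},u_0^{m}\in\mathbb{R}$, the two families of lines $(\ell_i)_{i\in\mathbb{Z}}$ and $(m_j)_{j\in\mathbb{Z}}$ given by $$\ell_{2k}=\mathbf{v}_+(u_0^{\ell}+k(s+\tilde s)),\qquad \ell_{2k+1}=\mathbf{v}_-(u_0^{\ell}+k(s+\tilde s)+s),$$ $$m_{2l}=\mathbf{v}_-(u_0^{m}+l(s+\tilde s)),\qquad m_{2l+1}=\mathbf{v}_+(u_0^{m}+l(s+\tilde s)+s),\qquad k,l\in\mathbb{Z},$$ constitute a hyperbolic/elliptic/Euclidean checkerboard incircular net (for $\varepsilon=-1$, $\varepsilon=1$, $\varepsilon=0$, respectively) tangent to the ellipse $$\frac{x_1^2}{\alpha^2}+\frac{x_2^2}{\beta^2}-x_3^2=0 .$$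
   Context: The Laguerre quadric is $\mathcal{B}=\{[x]\in\mathbb{R}\mathrm{P}^3: x_1^2+x_2^2+\varepsilon x_3^2-x_4^2=0\}$ ($\varepsilon=-1$ hyperbolic, $\varepsilon=1$ elliptic, $\varepsilon=0$ Euclidean). Oriented lines of the respective plane are identified with points of $\mathcal{B}$ (for $\varepsilon=0$ excluding the vertex $[0,0,1,0]$): $[x_1,x_2,x_3,x_4]$ represents the line $\{[y_1,y_2,y_3]: x_1y_1+x_2y_2+\varepsilon'x_3y_3=0\}$ in homogeneous coordinates of the plane, with $\varepsilon'=\varepsilon$ if $\varepsilon\ne0$ and $\varepsilon'=1$ if $\varepsilon=0$; changing the sign of $x_4$ reverses the orientation. Four oriented lines touch a common oriented (Laguerre) circle iff the corresponding points of $\mathcal{B}$ are coplanar. A checkerboard incircular net consists of two families $(\ell_i)_{i\in\mathbb{Z}}$, $(m_j)_{j\in\mathbb{Z}}$ of oriented lines such that for all $i,j$ with $i+j$ even the four lines $\ell_i,\ell_{i+1},m_j,m_{j+1}$ touch a common oriented circle. It is tangent to a conic if all of its lines are tangent to the conic. For $u\in\mathbb{R}$, with Jacobi elliptic functions of modulus $k$ (here and in the next two formulas $k$ denotes the modulus, not the integer index in the claim), $$\mathbf{v}_\pm(u)=\left[\frac{1}{\sqrt{1+\varepsilon\alpha^2}}\operatorname{cn}(u,k),\ \frac{1}{\sqrt{1+\varepsilon\beta^2}}\operatorname{sn}(u,k),\ \frac{\alpha}{\sqrt{1+\varepsilon\alpha^2}}\operatorname{dn}(u,k),\ \pm1\right],$$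 $$k^2=1-\frac{\beta^2(1+\varepsilon\alpha^2)}{\alpha^2(1+\varepsilon\beta^2)}.$$ *)

(* Defs.v *)
From Stdlib Require Import Reals ZArith.
From Coquelicot Require Import Coquelicot.
Open Scope R_scope.

(** * Jacobi elliptic functions of a real argument and modulus [0 <= k < 1] *)

Definition ellipticF (k phi : R) : R :=
  RInt (fun t => / sqrt (1 - k ^ 2 * sin t ^ 2)) 0 phi.

(* For [0 <= k < 1] the map [ellipticF k] is an increasing bijection of R;
   [jacobi_am k] is its inverse ([iota] picks the unique solution). *)
Definition jacobi_am (k u : R) : R :=
  iota (fun phi : R => ellipticF k phi = u).

Definition sn (u k : R) : R := sin (jacobi_am k u).
Definition cn (u k : R) : R := cos (jacobi_am k u).
Definition dn (u k : R) : R := sqrt (1 - k ^ 2 * sn u k ^ 2).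

(** * Homogeneous coordinates *)

(* Points of RP^2 and RP^3 are given by nonzero homogeneous coordinate vectors;
   every predicate on points below is invariant under nonzero scaling. *)
Record vec3 : Type := Vec3 { y1 : R; y2 : R; y3 : R }.
Record vec4 : Type := Vec4 { x1 : R; x2 : R; x3 : R; x4 : R }.

Definition zero3 : vec3 := Vec3 0 0 0.
Definition zero4 : vec4 := Vec4 0 0 0 0.

Definition add3 (p q : vec3) : vec3 :=
  Vec3 (y1 p + y1 q) (y2 p + y2 q) (y3 p + y3 q).

Definition scale4 (c : R) (x : vec4) : vec4 :=
  Vec4 (c * x1 x) (c * x2 x) (c * x3 x) (c * x4 x).

Definition dot4 (a x : vec4) : R :=
  x1 a * x1 x + x2 a * x2 x + x3 a * x3 x + x4 a * x4 x.

(* Equality in RP^3 of the points with homogeneous coordinates [x] and [y]. *)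
Definition same_point (x y : vec4) : Prop :=
  x <> zero4 /\ y <> zero4 /\ exists c : R, c <> 0 /\ x = scale4 c y.

(** * Laguerre geometry of the hyperbolic ([eps = -1]), Euclidean ([eps = 0])
      and elliptic ([eps = 1]) plane *)

Definition on_laguerre_quadric (eps : R) (x : vec4) : Prop :=
  x <> zero4 /\ x1 x ^ 2 + x2 x ^ 2 + eps * x3 x ^ 2 - x4 x ^ 2 = 0.

(* For [eps = 0] the quadric is a cone, whose vertex is not a line. *)
Definition oriented_line (eps : R) (x : vec4) : Prop :=
  on_laguerre_quadric eps x /\
  (eps = 0 -> ~ same_point x (Vec4 0 0 1 0)).

Definition eps' (eps : R) : R := if Req_dec_T eps 0 then 1 else eps.

(* The set of points of the line; the sign of [x4 x], relative to the other
   coordinates, only carries the orientation. *)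
Definition on_line (eps : R) (x : vec4) (y : vec3) : Prop :=
  y <> zero3 /\ x1 x * y1 y + x2 x * y2 y + eps' eps * x3 x * y3 y = 0.

(* An oriented Laguerre circle is a planar section of the quadric, viewed as
   the set of the oriented lines that touch it.  No section is excluded, so
   the degenerate ones (for [eps = 0], by planes through the vertex) count. *)
Definition laguerre_circle (eps : R) (C : vec4 -> Prop) : Prop :=
  exists a : vec4, a <> zero4 /\
    forall x : vec4, C x <-> oriented_line eps x /\ dot4 a x = 0.

Definition touch_common_circle (eps : R) (a b c d : vec4) : Prop :=
  exists C : vec4 -> Prop, laguerre_circle eps C /\ C a /\ C b /\ C c /\ C d.

Definition checkerboard_incircular_net (eps : R) (l m : Z -> vec4) : Prop :=
  (forall i : Z, oriented_line eps (l i)) /\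
  (forall j : Z, oriented_line eps (m j)) /\
  (forall i j : Z, Z.Even (i + j) ->
     touch_common_circle eps (l i) (l (i + 1)%Z) (m j) (m (j + 1)%Z)).

(** * Tangency to a conic *)

(* [q] is a quadratic form on R^3; this is twice its bilinear form. *)
Definition polar (q : vec3 -> R) (p y : vec3) : R :=
  q (add3 p y) - q p - q y.

(* A set of points of RP^2 is a tangent of the conic [q = 0] if it is the
   polar line of a point [p] of that conic. *)
Definition tangent_to_conic (q : vec3 -> R) (L : vec3 -> Prop) : Prop :=
  exists p : vec3, p <> zero3 /\ q p = 0 /\
    forall y : vec3, L y <-> y <> zero3 /\ polar q p y = 0.

Definition net_tangent_to_conic (eps : R) (l m : Z -> vec4) (q : vec3 -> R) : Prop :=
  (forall i : Z, tangent_to_conic q (on_line eps (l i))) /\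
  (forall j : Z, tangent_to_conic q (on_line eps (m j))).

Definition ellipse (alpha beta : R) (y : vec3) : R :=
  y1 y ^ 2 / alpha ^ 2 + y2 y ^ 2 / beta ^ 2 - y3 y ^ 2.

(** * The parametrization of the tangent lines of the ellipse *)

Definition modulus (eps alpha beta : R) : R :=
  sqrt (1 - (beta ^ 2 * (1 + eps * alpha ^ 2)) /
            (alpha ^ 2 * (1 + eps * beta ^ 2))).

Definition v (sigma eps alpha beta u : R) : vec4 :=
  let k := modulus eps alpha beta in
  Vec4 (/ sqrt (1 + eps * alpha ^ 2) * cn u k)
       (/ sqrt (1 + eps * beta ^ 2) * sn u k)
       (alpha / sqrt (1 + eps * alpha ^ 2) * dn u k)
       sigma.

Definition v_plus : R -> R -> R -> R -> vec4 := v 1.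
Definition v_minus : R -> R -> R -> R -> vec4 := v (-1).

(* Main.v *)
Require Import Defs.
From Stdlib Require Import Reals ZArith.
From Coquelicot Require Import Coquelicot.
From Stdlib Require Import Lra Lia Ranalysis5.
Open Scope R_scope.

(* The substitution of sn, cn, dn turns the Laguerre quadric and the tangency
   to the ellipse into identities for sn^2.  Coplanarity is the group law on the
   elliptic curve of tangent lines: v_+(a), v_+(d), v_-(b), v_-(c) are coplanar
   whenever a + d = b + c.  Writing a, d = w + p, w - p and b, c = w + q, w - q
   and expanding by the addition theorem, a plane contains both points of a pair
   iff the odd and the even part in p (resp. q) of its equation vanish, and the
   four equations so obtained have an explicit nonzero solution.  Around each
   circle of the net the arguments satisfy a + d = b + c. *)

(** * The elliptic integral and its inverse, the amplitude *)

Lemma one_minus_mult_sin_sqr_pos (k t : R) : k ^ 2 < 1 -> 0 < 1 - k ^ 2 * sin t ^ 2.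
Proof.
intros Hk.
generalize (sin2_cos2 t); unfold Rsqr; intros H.
generalize (pow2_ge_0 (cos t)) (pow2_ge_0 (sin t)) (pow2_ge_0 k); intros.
nra.
Qed.

Lemma ellipticF_deriv (k phi : R) : k ^ 2 < 1 ->
  is_derive (ellipticF k) phi (/ sqrt (1 - k ^ 2 * sin phi ^ 2)).
Proof.
intros Hk.
assert (Hc : forall z, continuous (fun t => / sqrt (1 - k ^ 2 * sin t ^ 2)) z).
{ intros z; apply (ex_derive_continuous (V := R_NormedModule)); auto_derive.
  generalize (one_minus_mult_sin_sqr_pos k z Hk); intros Hz; simpl in Hz.
  repeat split; auto; apply Rgt_not_eq, sqrt_lt_R0; exact Hz. }
apply (is_derive_RInt (fun t => / sqrt (1 - k ^ 2 * sin t ^ 2)) (ellipticF k) 0 phi).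
- apply filter_forall; intros b.
  apply (RInt_correct (V := R_CompleteNormedModule)),
    (ex_RInt_continuous (V := R_CompleteNormedModule)).
  intros z _; apply Hc.
- apply Hc.
Qed.

Lemma inv_sqrt_modulus_ge_1 (k t : R) : k ^ 2 < 1 ->
  1 <= / sqrt (1 - k ^ 2 * sin t ^ 2).
Proof.
intros Hk.
rewrite <- Rinv_1 at 1.
apply Rinv_le_contravar.
- apply sqrt_lt_R0, one_minus_mult_sin_sqr_pos, Hk.
- rewrite <- sqrt_1 at 2; apply sqrt_le_1_alt.
  generalize (pow2_ge_0 k) (pow2_ge_0 (sin t)); nra.
Qed.

(** The integrand is at least 1, so the mean value theorem shows that [ellipticF k] stretches
    distances. Injectivity, surjectivity and continuity of the inverse all follow from this. *)
Lemma ellipticF_expanding (k x y : R) : k ^ 2 < 1 -> x <= y ->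
  y - x <= ellipticF k y - ellipticF k x.
Proof.
intros Hk Hxy.
destruct (MVT_gen (ellipticF k) x y (fun t => / sqrt (1 - k ^ 2 * sin t ^ 2)))
  as [c [_ Hc]].
- intros t _; apply ellipticF_deriv, Hk.
- intros t _; apply continuity_pt_filterlim, (ex_derive_continuous (V := R_NormedModule)).
  eexists; apply ellipticF_deriv, Hk.
- rewrite Hc; generalize (inv_sqrt_modulus_ge_1 k c Hk); nra.
Qed.

Lemma ellipticF_expanding_Rabs (k x y : R) : k ^ 2 < 1 ->
  Rabs (y - x) <= Rabs (ellipticF k y - ellipticF k x).
Proof.
intros Hk.
destruct (Rle_or_lt x y) as [H | H].
- generalize (ellipticF_expanding k x y Hk H); intros.
  rewrite !Rabs_pos_eq; lra.
- generalize (ellipticF_expanding k y x Hk (Rlt_le _ _ H)); intros.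
  rewrite !Rabs_left; lra.
Qed.

Lemma ellipticF_0 (k : R) : ellipticF k 0 = 0.
Proof. exact (RInt_point 0 _). Qed.

Lemma ellipticF_inj (k x y : R) : k ^ 2 < 1 ->
  ellipticF k x = ellipticF k y -> x = y.
Proof.
intros Hk H.
generalize (ellipticF_expanding_Rabs k x y Hk); rewrite H, Rminus_diag, Rabs_R0.
generalize (Rabs_pos (y - x)); intros H1 H2.
destruct (Req_dec (y - x) 0) as [H3 | H3]; [lra |].
generalize (Rabs_pos_lt _ H3); lra.
Qed.

(** By expansion from 0, the values at [- Rabs u] and [Rabs u] enclose [u]; the intermediate value
    theorem applies. *)
Lemma ellipticF_surj (k u : R) : k ^ 2 < 1 -> exists phi, ellipticF k phi = u.
Proof.
intros Hk.
assert (Hu := Rabs_pos u).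
assert (H1 := ellipticF_expanding k 0 (Rabs u) Hk Hu).
assert (H2 := ellipticF_expanding k (- Rabs u) 0 Hk ltac:(lra)).
rewrite ellipticF_0 in H1, H2.
destruct (IVT_gen (ellipticF k) (- Rabs u) (Rabs u) u) as [x [_ Hx]].
- intros t; apply continuity_pt_filterlim, (ex_derive_continuous (V := R_NormedModule)).
  eexists; apply ellipticF_deriv, Hk.
- generalize (Rle_abs u) (Rle_abs (- u)); rewrite Rabs_Ropp; intros.
  rewrite Rmin_left, Rmax_right by lra; lra.
- now exists x.
Qed.

Lemma ellipticF_am (k u : R) : k ^ 2 < 1 -> ellipticF k (jacobi_am k u) = u.
Proof.
intros Hk.
apply (iota_correct (V := R_CompleteNormedModule) (fun phi : R => ellipticF k phi = u)).
destruct (ellipticF_surj k u Hk) as [phi H].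
exists phi; split; [exact H |].
intros psi H'; apply (ellipticF_inj k); [exact Hk | congruence].
Qed.

(** The inverse of an expanding map is 1-Lipschitz, so [e] itself serves as the delta. *)
Lemma am_continuous (k u : R) : k ^ 2 < 1 -> continuity_pt (jacobi_am k) u.
Proof.
intros Hk e He; exists e; split; [exact He |].
intros x [_ Hx]; simpl in *; unfold Rdist in *.
generalize (ellipticF_expanding_Rabs k (jacobi_am k u) (jacobi_am k x) Hk).
rewrite !ellipticF_am by exact Hk; lra.
Qed.

Lemma dn_pos (k u : R) : k ^ 2 < 1 -> 0 < dn u k.
Proof. intros Hk; apply sqrt_lt_R0, one_minus_mult_sin_sqr_pos, Hk. Qed.

(** Inverse function rule: [dn u k] is the reciprocal of the integrand at [jacobi_am k u]. *)
Lemma am_deriv (k u : R) : k ^ 2 < 1 -> is_derive (jacobi_am k) u (dn u k).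
Proof.
intros Hk; apply is_derive_Reals.
assert (Hd : forall a, derivable_pt_lim (ellipticF k) a (/ sqrt (1 - k ^ 2 * sin a ^ 2)))
  by (intros a; apply is_derive_Reals, ellipticF_deriv, Hk).
(* The inverse function rule asks for differentiability of [ellipticF k] on an interval around the
   amplitude of [u]; the one between the amplitudes of [u - 1] and [u + 1] is taken. *)
set (Prf := fun a (_ : jacobi_am k (u - 1) <= a <= jacobi_am k (u + 1)) =>
  exist (derivable_pt_abs (ellipticF k) a) _ (Hd a)).
assert (Hmono : forall x y, x <= y -> jacobi_am k x <= jacobi_am k y).
{ intros x y Hxy; apply Rnot_lt_le; intros H.
  generalize (ellipticF_expanding k _ _ Hk (Rlt_le _ _ H)).
  rewrite !ellipticF_am by exact Hk; lra. }
assert (Hin : jacobi_am k (u - 1) <= jacobi_am k u <= jacobi_am k (u + 1))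
  by (split; apply Hmono; lra).
assert (Hdn := dn_pos k u Hk).
replace (dn u k) with (1 / derive_pt (ellipticF k) (jacobi_am k u) (Prf _ Hin)).
- apply derivable_pt_lim_recip_interv with (lb := u - 1) (ub := u + 1); try lra.
  + apply am_continuous, Hk.
  + intros x _; apply ellipticF_am, Hk.
  + simpl; apply Rinv_neq_0_compat, Rgt_not_eq, Hdn.
- simpl; rewrite Rdiv_1_l, Rinv_inv; reflexivity.
Qed.

(** * Quadratic relations and derivatives of sn, cn, dn *)

Lemma cn_sqr (k u : R) : cn u k ^ 2 = 1 - sn u k ^ 2.
Proof.
generalize (sin2_cos2 (jacobi_am k u)); unfold Rsqr, cn, sn; intros; lra.
Qed.

Lemma dn_sqr (k u : R) : k ^ 2 < 1 -> dn u k ^ 2 = 1 - k ^ 2 * sn u k ^ 2.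
Proof.
intros Hk; unfold dn; rewrite pow2_sqrt; [reflexivity |].
apply Rlt_le, one_minus_mult_sin_sqr_pos, Hk.
Qed.

Lemma sn_deriv (k u : R) : k ^ 2 < 1 ->
  is_derive (fun t : R => sn t k) u (cn u k * dn u k).
Proof.
intros Hk.
rewrite Rmult_comm.
apply (is_derive_comp sin (jacobi_am k)); [apply is_derive_sin | apply am_deriv, Hk].
Qed.

Lemma cn_deriv (k u : R) : k ^ 2 < 1 ->
  is_derive (fun t : R => cn t k) u (- sn u k * dn u k).
Proof.
intros Hk.
rewrite Rmult_comm.
apply (is_derive_comp cos (jacobi_am k)); [apply is_derive_cos | apply am_deriv, Hk].
Qed.

Lemma dn_deriv (k u : R) : k ^ 2 < 1 ->
  is_derive (fun t : R => dn t k) u (- k ^ 2 * sn u k * cn u k).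
Proof.
intros Hk.
assert (Hdn := dn_pos k u Hk).
assert (Hs := sn_deriv k u Hk).
unfold dn at 1; auto_derive.
- repeat split; [eexists; exact Hs |].
  exact (one_minus_mult_sin_sqr_pos k (jacobi_am k u) Hk).
- replace (Derive _ u) with (cn u k * dn u k)
    by (symmetry; apply is_derive_unique, Hs).
  fold (dn u k).
  change (sqrt _) with (dn u k).
  field; lra.
Qed.

(** * Values at zero and parity *)

Lemma am_0 (k : R) : k ^ 2 < 1 -> jacobi_am k 0 = 0.
Proof.
intros Hk; apply (ellipticF_inj k); [exact Hk |].
now rewrite ellipticF_am, ellipticF_0.
Qed.

Lemma sn_0 (k : R) : k ^ 2 < 1 -> sn 0 k = 0.
Proof. intros Hk; unfold sn; rewrite am_0 by exact Hk; apply sin_0. Qed.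

Lemma cn_0 (k : R) : k ^ 2 < 1 -> cn 0 k = 1.
Proof. intros Hk; unfold cn; rewrite am_0 by exact Hk; apply cos_0. Qed.

Lemma dn_0 (k : R) : k ^ 2 < 1 -> dn 0 k = 1.
Proof.
intros Hk; unfold dn; rewrite sn_0 by exact Hk.
replace (1 - k ^ 2 * 0 ^ 2) with 1 by ring; apply sqrt_1.
Qed.

Lemma constant_of_derive_zero (f : R -> R) :
  (forall t, is_derive f t 0) -> forall a b, f a = f b.
Proof.
intros H a b.
destruct (Rtotal_order a b) as [H0 | [H0 | H0]].
- now apply (eq_is_derive f a b); [intros t _; apply H |].
- now rewrite H0.
- symmetry; now apply (eq_is_derive f b a); [intros t _; apply H |].
Qed.

(** The integrand is even, so F(t) + F(-t) has zero derivative and keeps its value at 0. *)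
Lemma ellipticF_opp (k phi : R) : k ^ 2 < 1 -> ellipticF k (- phi) = - ellipticF k phi.
Proof.
intros Hk.
enough (H : ellipticF k phi + ellipticF k (- phi) = ellipticF k 0 + ellipticF k (- 0))
  by (rewrite Ropp_0, ellipticF_0 in H; lra).
apply (constant_of_derive_zero (fun t => ellipticF k t + ellipticF k (- t))).
intros t.
assert (H1 := ellipticF_deriv k t Hk).
assert (H2 := ellipticF_deriv k (- t) Hk).
auto_derive; [repeat split; eexists; eassumption |].
change (fun x => ellipticF k x) with (ellipticF k).
rewrite (is_derive_unique _ _ _ H1), (is_derive_unique _ _ _ H2), sin_neg.
replace ((- sin t) ^ 2) with (sin t ^ 2) by ring; ring.
Qed.

Lemma am_opp (k u : R) : k ^ 2 < 1 -> jacobi_am k (- u) = - jacobi_am k u.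
Proof.
intros Hk; apply (ellipticF_inj k); [exact Hk |].
now rewrite ellipticF_opp, !ellipticF_am.
Qed.

Lemma sn_opp (k u : R) : k ^ 2 < 1 -> sn (- u) k = - sn u k.
Proof. intros Hk; unfold sn; rewrite am_opp by exact Hk; apply sin_neg. Qed.

Lemma cn_opp (k u : R) : k ^ 2 < 1 -> cn (- u) k = cn u k.
Proof. intros Hk; unfold cn; rewrite am_opp by exact Hk; apply cos_neg. Qed.

Lemma dn_opp (k u : R) : k ^ 2 < 1 -> dn (- u) k = dn u k.
Proof.
intros Hk; unfold dn; rewrite sn_opp by exact Hk.
now replace ((- sn u k) ^ 2) with (sn u k ^ 2) by ring.
Qed.

(** * Addition theorems *)

(** Since sn(w)^2 <= 1, the denominator is at least 1 - k^2 sn(u)^2, which is positive. *)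
Lemma addition_denominator_pos (k u w : R) : k ^ 2 < 1 ->
  0 < 1 - k ^ 2 * sn u k ^ 2 * sn w k ^ 2.
Proof.
intros Hk.
generalize (cn_sqr k w) (pow2_ge_0 (cn w k)) (pow2_ge_0 (sn w k))
  (one_minus_mult_sin_sqr_pos k (jacobi_am k u) Hk); fold (sn u k); intros.
generalize (pow2_ge_0 (k * sn u k)); intros; nra.
Qed.

(* Along [u1 + u2 = c] each right-hand side below has zero derivative, and at
   [u1 = 0] it takes the value of the left-hand side. *)
Ltac addition_law k u w Hk f :=
  transitivity (f 0 (u + w));
  [ unfold f; rewrite sn_0, cn_0, dn_0 by exact Hk; field
  | replace (f 0 (u + w)) with (f 0 (u + w - 0)) by (f_equal; ring);
    replace (f u w) with (f u (u + w - u)) by (f_equal; ring);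
    apply (constant_of_derive_zero (fun t => f t (u + w - t)));
    intros t; unfold f;
    let c := constr:(u + w - t) in
    assert (Hs1 := sn_deriv k t Hk); assert (Hs2 := sn_deriv k c Hk);
    assert (Hc1 := cn_deriv k t Hk); assert (Hc2 := cn_deriv k c Hk);
    assert (Hd1 := dn_deriv k t Hk); assert (Hd2 := dn_deriv k c Hk);
    assert (Hp := addition_denominator_pos k t c Hk);
    auto_derive;
    [ repeat split; solve [eexists; eassumption | simpl in Hp; unfold Rminus in *; lra]
    | change (u + w + - t) with c in *;
      rewrite (is_derive_unique _ _ _ Hs1), (is_derive_unique _ _ _ Hs2),
        (is_derive_unique _ _ _ Hc1), (is_derive_unique _ _ _ Hc2),
        ?(is_derive_unique _ _ _ Hd1), ?(is_derive_unique _ _ _ Hd2);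
      assert (Ec1 := cn_sqr k t); assert (Ec2 := cn_sqr k c);
      assert (Ed1 := dn_sqr k t Hk); assert (Ed2 := dn_sqr k c Hk);
      field_simplify; [| simpl in *; lra ..];
      apply Rmult_eq_0_compat_r; ring [Ec1 Ec2 Ed1 Ed2] ] ].

Lemma sn_add (k u w : R) : k ^ 2 < 1 ->
  sn (u + w) k = (sn u k * cn w k * dn w k + sn w k * cn u k * dn u k) /
                 (1 - k ^ 2 * sn u k ^ 2 * sn w k ^ 2).
Proof.
intros Hk.
set (f := fun u w => (sn u k * cn w k * dn w k + sn w k * cn u k * dn u k) /
                 (1 - k ^ 2 * sn u k ^ 2 * sn w k ^ 2)).
change (sn (u + w) k = f u w).
addition_law k u w Hk f.
Qed.

Lemma cn_add (k u w : R) : k ^ 2 < 1 ->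
  cn (u + w) k = (cn u k * cn w k - sn u k * sn w k * dn u k * dn w k) /
                 (1 - k ^ 2 * sn u k ^ 2 * sn w k ^ 2).
Proof.
intros Hk.
set (f := fun u w => (cn u k * cn w k - sn u k * sn w k * dn u k * dn w k) /
                 (1 - k ^ 2 * sn u k ^ 2 * sn w k ^ 2)).
change (cn (u + w) k = f u w).
addition_law k u w Hk f.
Qed.

Lemma dn_add (k u w : R) : k ^ 2 < 1 ->
  dn (u + w) k = (dn u k * dn w k - k ^ 2 * sn u k * sn w k * cn u k * cn w k) /
                 (1 - k ^ 2 * sn u k ^ 2 * sn w k ^ 2).
Proof.
intros Hk.
set (f := fun u w => (dn u k * dn w k - k ^ 2 * sn u k * sn w k * cn u k * cn w k) /
                 (1 - k ^ 2 * sn u k ^ 2 * sn w k ^ 2)).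
change (dn (u + w) k = f u w).
addition_law k u w Hk f.
Qed.

Lemma jacobi_sub (k u w : R) : k ^ 2 < 1 ->
  sn (u - w) k = (sn u k * cn w k * dn w k - sn w k * cn u k * dn u k) /
                 (1 - k ^ 2 * sn u k ^ 2 * sn w k ^ 2) /\
  cn (u - w) k = (cn u k * cn w k + sn u k * sn w k * dn u k * dn w k) /
                 (1 - k ^ 2 * sn u k ^ 2 * sn w k ^ 2) /\
  dn (u - w) k = (dn u k * dn w k + k ^ 2 * sn u k * sn w k * cn u k * cn w k) /
                 (1 - k ^ 2 * sn u k ^ 2 * sn w k ^ 2).
Proof.
intros Hk; replace (u - w) with (u + - w) by ring.
rewrite sn_add, cn_add, dn_add, sn_opp, cn_opp, dn_opp by exact Hk.
assert (H := addition_denominator_pos k u w Hk).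
repeat split; field; simpl in *; nra.
Qed.

(** * Coplanarity of four points with equal parameter sums *)

(** The addition theorems for [w + p] and [w - p] share their denominator. Multiplied by it, the
    plane equation becomes [even + sn p k * odd] at [w + p] and [even - sn p k * odd] at [w - p];
    the two hypotheses say that both parts vanish. *)
Lemma jacobi_line_through_sum_diff (k w p A B C E : R) : k ^ 2 < 1 ->
  A * sn w k * dn w k * dn p k + C * k ^ 2 * sn w k * cn w k * cn p k =
    B * cn w k * dn w k ->
  A * cn w k * cn p k + B * sn w k * cn p k * dn p k + C * dn w k * dn p k +
    E * (1 - k ^ 2 * sn w k ^ 2 * sn p k ^ 2) = 0 ->
  A * cn (w + p) k + B * sn (w + p) k + C * dn (w + p) k + E = 0 /\
  A * cn (w - p) k + B * sn (w - p) k + C * dn (w - p) k + E = 0.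
Proof.
intros Hk Hodd Heven.
destruct (jacobi_sub k w p Hk) as [-> [-> ->]].
rewrite sn_add, cn_add, dn_add by exact Hk.
assert (H := addition_denominator_pos k w p Hk).
set (odd := B * cn w k * dn w k -
  (A * sn w k * dn w k * dn p k + C * k ^ 2 * sn w k * cn w k * cn p k)).
set (even := A * cn w k * cn p k + B * sn w k * cn p k * dn p k + C * dn w k * dn p k +
  E * (1 - k ^ 2 * sn w k ^ 2 * sn p k ^ 2)) in Heven.
assert (Hodd0 : odd = 0) by (unfold odd; rewrite Hodd; ring).
split; field_simplify_eq; try (simpl in *; lra).
- transitivity (even + sn p k * odd); [unfold even, odd; ring |].
  rewrite Heven, Hodd0; ring.
- transitivity (even - sn p k * odd); [unfold even, odd; ring |].
  rewrite Heven, Hodd0; ring.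
Qed.

(** This is coplanarity up to a rescaling of the first three coordinates. The constant term changes
    sign for [b] and [c] because the last coordinate of [v_minus] is -1. *)
Lemma jacobi_coplanar (k a b c d : R) : 0 < k ^ 2 < 1 -> a + d = b + c ->
  exists A B C E : R, ~ (A = 0 /\ B = 0 /\ C = 0 /\ E = 0) /\
    A * cn a k + B * sn a k + C * dn a k + E = 0 /\
    A * cn d k + B * sn d k + C * dn d k + E = 0 /\
    A * cn b k + B * sn b k + C * dn b k - E = 0 /\
    A * cn c k + B * sn c k + C * dn c k - E = 0.
Proof.
intros [Hk0 Hk] Hsum.
set (w := (a + d) / 2); set (p := (a - d) / 2); set (q := (b - c) / 2).
replace a with (w + p) by (unfold w, p; field).
replace d with (w - p) by (unfold w, p; field).
replace b with (w + q) by (unfold w, q; lra).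
replace c with (w - q) by (unfold w, q; lra).
clearbody w p q; clear Hsum.
enough (H : exists A B C E : R, ~ (A = 0 /\ B = 0 /\ C = 0 /\ E = 0) /\
  (A * sn w k * dn w k * dn p k + C * k ^ 2 * sn w k * cn w k * cn p k =
    B * cn w k * dn w k /\
  A * sn w k * dn w k * dn q k + C * k ^ 2 * sn w k * cn w k * cn q k =
    B * cn w k * dn w k) /\
  A * cn w k * cn p k + B * sn w k * cn p k * dn p k + C * dn w k * dn p k +
    E * (1 - k ^ 2 * sn w k ^ 2 * sn p k ^ 2) = 0 /\
  A * cn w k * cn q k + B * sn w k * cn q k * dn q k + C * dn w k * dn q k +
    - E * (1 - k ^ 2 * sn w k ^ 2 * sn q k ^ 2) = 0).
{ destruct H as [A [B [C [E [Hnz [[H1 H2] [H3 H4]]]]]]].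
  destruct (jacobi_line_through_sum_diff k w p A B C E Hk H1 H3).
  destruct (jacobi_line_through_sum_diff k w q A B C (- E) Hk H2 H4).
  exists A, B, C, E; auto. }
assert (Ew := cn_sqr k w); assert (Ep := cn_sqr k p); assert (Eq := cn_sqr k q).
assert (Fw := dn_sqr k w Hk); assert (Fp := dn_sqr k p Hk); assert (Fq := dn_sqr k q Hk).
assert (Gw := dn_pos k w Hk); assert (Gp := dn_pos k p Hk); assert (Gq := dn_pos k q Hk).
revert Ew Ep Eq Fw Fp Fq Gw Gp Gq.
(* What remains is algebra in nine numbers subject to the quadratic relations and the positivity of
   the dn values. *)
generalize (cn w k) (sn w k) (dn w k) (cn p k) (sn p k) (dn p k) (cn q k) (sn q k) (dn q k).
intros cw sw dw cp sp dp cq sq dq Ew Ep Eq Fw Fp Fq Gw Gp Gq.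
destruct (Req_dec cp cq) as [Hpq | Hpq].
- (* [p] and [q] give the same two lines up to orientation: take the plane
     [E = 0] through them, as a cross product. *)
  assert (Hd : dp = dq).
  { apply Rsqr_inj; try lra; unfold Rsqr; subst cq; nra. }
  subst cq dq.
  exists (- cw * dp * (dw ^ 2 + k ^ 2 * sw ^ 2 * cp ^ 2)),
    (sw * (k ^ 2 * cw ^ 2 * cp ^ 2 - dw ^ 2 * dp ^ 2)),
    (dw * cp * (sw ^ 2 * dp ^ 2 + cw ^ 2)), 0.
  split; [| repeat split; ring].
  (* A vanishing first coefficient forces [cw = 0]; the second is then -sw dw^2 dp^2, so [sw = 0] as
     well, against cw^2 + sw^2 = 1. *)
  intros [H1 [H2 _]].
  assert (Hpos : 0 < dp * (dw ^ 2 + k ^ 2 * sw ^ 2 * cp ^ 2)).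
  { apply Rmult_lt_0_compat; [exact Gp |].
    generalize (pow2_ge_0 (k * sw * cp)); nra. }
  rewrite Rmult_assoc in H1.
  assert (Hcw : cw = 0) by (destruct (Rmult_integral _ _ H1); lra).
  subst cw.
  assert (Hdd : 0 < dw ^ 2 * dp ^ 2) by (apply Rmult_lt_0_compat; apply pow_lt; assumption).
  destruct (Rmult_integral _ _ H2) as [Hsw | Hsw]; [subst sw |]; lra.
(* Subtracting the two odd equations fixes the ratio of [A] and [C], and either one then gives [B].
   The even equations at sw = 0 give [E]: since k^2 cp^2 - dp^2 = k^2 - 1, and likewise for [q],
   they agree on it with the required opposite signs. *)
- exists (k ^ 2 * cw * (cp - cq)), (k ^ 2 * sw * (cp * dq - cq * dp)),
    (- dw * (dp - dq)), (1 - k ^ 2 + k ^ 2 * cp * cq - dp * dq).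
  split.
  (* If [A], [B], [C] vanish, then [dp = dq], hence [cq = - cp] with [cp] nonzero. This forces
     [cw = 0] and [sw = 0], a contradiction. *)
  + intros [H1 [H2 [H3 _]]].
    assert (Hk2 : k ^ 2 <> 0) by lra.
    assert (Hd : dp = dq) by (destruct (Rmult_integral _ _ H3); lra).
    assert (Hc : cq = - cp).
    { subst dq.
      assert (Hc : k ^ 2 * ((cp - cq) * (cp + cq)) = 0).
      { transitivity (k ^ 2 * (cp ^ 2 - cq ^ 2)); [ring | rewrite Ep, Eq; lra]. }
      destruct (Rmult_integral _ _ Hc) as [H | H]; [lra |].
      destruct (Rmult_integral _ _ H); lra. }
    subst cq dq.
    assert (Hcw : cw = 0).
    { destruct (Rmult_integral _ _ H1) as [H | H]; [destruct (Rmult_integral _ _ H) |]; lra. }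
    replace (cp * dp - - cp * dp) with (2 * cp * dp) in H2 by ring.
    assert (Hcd : 2 * cp * dp <> 0) by (apply Rmult_integral_contrapositive; split; lra).
    assert (Hsw : sw = 0).
    { destruct (Rmult_integral _ _ H2) as [H | H]; [destruct (Rmult_integral _ _ H) |]; lra. }
    subst; lra.
  + repeat split; ring [Ew Ep Eq Fw Fp Fq].
Qed.

(** * The modulus, the Laguerre quadric and tangency to the ellipse *)

(** Over the common denominator the terms with [eps] cancel in the numerator, so alpha > beta makes
    the radicand positive and the square root can be undone. *)
Lemma modulus_sqr (eps alpha beta : R) : alpha > beta -> beta > 0 ->
  1 + eps * alpha ^ 2 > 0 -> 1 + eps * beta ^ 2 > 0 ->
  modulus eps alpha beta ^ 2 =
    (alpha ^ 2 - beta ^ 2) / (alpha ^ 2 * (1 + eps * beta ^ 2)).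
Proof.
intros Hab Hb Ha' Hb'; unfold modulus.
assert (E : 1 - beta ^ 2 * (1 + eps * alpha ^ 2) / (alpha ^ 2 * (1 + eps * beta ^ 2)) =
  (alpha ^ 2 - beta ^ 2) / (alpha ^ 2 * (1 + eps * beta ^ 2))) by (field; lra).
rewrite E; apply pow2_sqrt, Rlt_le, Rdiv_lt_0_compat; [nra |].
apply Rmult_lt_0_compat; [apply pow_lt |]; lra.
Qed.

Lemma modulus_sqr_bounds (eps alpha beta : R) : alpha > beta -> beta > 0 ->
  1 + eps * alpha ^ 2 > 0 -> 1 + eps * beta ^ 2 > 0 ->
  0 < modulus eps alpha beta ^ 2 < 1.
Proof.
intros Hab Hb Ha' Hb'.
rewrite (modulus_sqr eps alpha beta) by assumption.
assert (0 < alpha ^ 2 * (1 + eps * beta ^ 2))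
  by (apply Rmult_lt_0_compat; [apply pow_lt |]; lra).
assert (0 < beta ^ 2 * (1 + eps * alpha ^ 2))
  by (apply Rmult_lt_0_compat; [apply pow_lt |]; lra).
split.
- apply Rdiv_lt_0_compat; [nra | assumption].
- apply Rlt_div_l; [assumption | lra].
Qed.

(** All three squares are affine in sn^2, so any diagonal quadratic equation for the point can be
    checked coefficientwise. *)
Lemma v_coords_sqr (sigma eps alpha beta u : R) : alpha > beta -> beta > 0 ->
  1 + eps * alpha ^ 2 > 0 -> 1 + eps * beta ^ 2 > 0 ->
  let x := v sigma eps alpha beta u in
  let s := sn u (modulus eps alpha beta) in
  x1 x ^ 2 = (1 - s ^ 2) / (1 + eps * alpha ^ 2) /\
  x2 x ^ 2 = s ^ 2 / (1 + eps * beta ^ 2) /\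
  x3 x ^ 2 = (alpha ^ 2 - (alpha ^ 2 - beta ^ 2) / (1 + eps * beta ^ 2) * s ^ 2) /
    (1 + eps * alpha ^ 2).
Proof.
intros Hab Hb Ha' Hb'.
destruct (modulus_sqr_bounds eps alpha beta) as [_ Hk]; try assumption.
simpl x1; simpl x2; simpl x3; unfold Rdiv at 3.
rewrite !Rpow_mult_distr, !pow_inv, !pow2_sqrt by lra.
rewrite cn_sqr, dn_sqr, modulus_sqr by assumption.
repeat split; field; lra.
Qed.

(** The nonzero last coordinate separates the point both from the zero vector and from the vertex of
    the cone. *)
Lemma v_oriented_line (sigma eps alpha beta u : R) : sigma ^ 2 = 1 ->
  alpha > beta -> beta > 0 ->
  1 + eps * alpha ^ 2 > 0 -> 1 + eps * beta ^ 2 > 0 ->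
  oriented_line eps (v sigma eps alpha beta u).
Proof.
intros Hsigma Hab Hb Ha' Hb'.
assert (Hs0 : sigma <> 0) by (intros ->; lra).
split; [split |].
- intros H; apply Hs0; exact (f_equal x4 H).
- destruct (v_coords_sqr sigma eps alpha beta u) as [-> [-> ->]]; try assumption.
  change (x4 (v sigma eps alpha beta u)) with sigma; rewrite Hsigma.
  field; lra.
- intros _ [_ [_ [c [_ H]]]]; apply Hs0.
  apply (f_equal x4) in H; simpl in H; lra.
Qed.

Lemma eps'_sqr (eps : R) : eps = -1 \/ eps = 0 \/ eps = 1 -> eps' eps ^ 2 = 1.
Proof.
intros H; unfold eps'; destruct (Req_dec_T eps 0); [ring |].
destruct H as [-> | [-> | ->]]; lra.
Qed.

Lemma v_tangent (sigma eps alpha beta u : R) : sigma ^ 2 = 1 ->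
  eps = -1 \/ eps = 0 \/ eps = 1 ->
  alpha > beta -> beta > 0 ->
  1 + eps * alpha ^ 2 > 0 -> 1 + eps * beta ^ 2 > 0 ->
  tangent_to_conic (ellipse alpha beta) (on_line eps (v sigma eps alpha beta u)).
Proof.
intros Hsigma Heps Hab Hb Ha' Hb'.
destruct (v_coords_sqr sigma eps alpha beta u) as [E1 [E2 E3]]; try assumption.
assert (E' := eps'_sqr eps Heps).
destruct (modulus_sqr_bounds eps alpha beta) as [_ Hk]; try assumption.
(* Positivity of dn keeps the third coordinate of the contact point below from vanishing. *)
assert (Hx3 : 0 < x3 (v sigma eps alpha beta u)).
{ simpl; apply Rmult_lt_0_compat; [apply Rdiv_lt_0_compat; [lra |] | apply dn_pos, Hk].
  apply sqrt_lt_R0; exact Ha'. }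
set (x := v sigma eps alpha beta u) in *; clearbody x.
(* The contact point is the pole of the line: its coefficients times the inverse of the matrix
   diag(1/alpha^2, 1/beta^2, -1) of the conic. That it lies on the ellipse is the dual conic
   equation alpha^2 x1^2 + beta^2 x2^2 = x3^2. *)
exists (Vec3 (alpha ^ 2 * x1 x) (beta ^ 2 * x2 x) (- eps' eps * x3 x)).
split; [| split].
- intros H; apply (f_equal y3) in H; simpl in H.
  destruct (Rmult_integral _ _ H) as [H0 | H0]; [| lra].
  replace (eps' eps) with 0 in E' by lra; lra.
- unfold ellipse; simpl y1; simpl y2; simpl y3.
  transitivity (alpha ^ 2 * x1 x ^ 2 + beta ^ 2 * x2 x ^ 2 - eps' eps ^ 2 * x3 x ^ 2);
    [field; lra |].
  rewrite E', E1, E2, E3; field; lra.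
- intros y; unfold on_line, polar, ellipse, add3; simpl y1; simpl y2; simpl y3.
  match goal with |- _ <-> _ /\ ?P = 0 =>
    replace P with (2 * (x1 x * y1 y + x2 x * y2 y + eps' eps * x3 x * y3 y))
      by (field; lra) end.
  split; intros [Hy H]; split; try exact Hy; lra.
Qed.

Lemma v_coplanar (eps alpha beta a b c d : R) :
  alpha > beta -> beta > 0 ->
  1 + eps * alpha ^ 2 > 0 -> 1 + eps * beta ^ 2 > 0 ->
  a + d = b + c ->
  exists n : vec4, n <> zero4 /\
    dot4 n (v_plus eps alpha beta a) = 0 /\ dot4 n (v_plus eps alpha beta d) = 0 /\
    dot4 n (v_minus eps alpha beta b) = 0 /\ dot4 n (v_minus eps alpha beta c) = 0.
Proof.
intros Hab Hb Ha' Hb' Hsum.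
destruct (jacobi_coplanar (modulus eps alpha beta) a b c d)
  as [A [B [C [E [Hnz [H1 [H2 [H3 H4]]]]]]]];
  [apply modulus_sqr_bounds; assumption | exact Hsum |].
assert (Hsa : 0 < sqrt (1 + eps * alpha ^ 2)) by (apply sqrt_lt_R0; lra).
assert (Hsb : 0 < sqrt (1 + eps * beta ^ 2)) by (apply sqrt_lt_R0; lra).
(* The factors undo the normalization of the coordinates of [v], so that the plane equation becomes
   the one in cn, sn, dn. *)
set (n := Vec4 (A * sqrt (1 + eps * alpha ^ 2)) (B * sqrt (1 + eps * beta ^ 2))
  (C * (sqrt (1 + eps * alpha ^ 2) / alpha)) E).
assert (Hdot : forall sigma u, dot4 n (v sigma eps alpha beta u) =
  A * cn u (modulus eps alpha beta) + B * sn u (modulus eps alpha beta) +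
  C * dn u (modulus eps alpha beta) + E * sigma).
{ intros sigma u; unfold dot4, n, v; cbn [x1 x2 x3 x4].
  field; repeat split; lra. }
exists n; split.
- intros H; apply Hnz.
  assert (Hq : 0 < sqrt (1 + eps * alpha ^ 2) / alpha) by (apply Rdiv_lt_0_compat; lra).
  assert (HA := f_equal x1 H); assert (HB := f_equal x2 H);
    assert (HC := f_equal x3 H); assert (HE := f_equal x4 H).
  unfold n, zero4 in HA, HB, HC, HE; cbn [x1 x2 x3 x4] in HA, HB, HC, HE.
  apply Rmult_integral in HA, HB, HC.
  destruct HA, HB, HC; repeat split; lra.
- unfold v_plus, v_minus; rewrite !Hdot; repeat split; lra.
Qed.

(** * Independence of the homogeneous representatives *)

Lemma oriented_line_same_point (eps : R) (x y : vec4) :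
  same_point x y -> oriented_line eps y -> oriented_line eps x.
Proof.
intros [Hx [Hy [c [Hc ->]]]] [[_ Hq] Hv].
split; [split; [exact Hx |] |].
- simpl; transitivity (c ^ 2 * (x1 y ^ 2 + x2 y ^ 2 + eps * x3 y ^ 2 - x4 y ^ 2));
    [ring | rewrite Hq; ring].
- intros H0 [_ [Hw [d [Hd H]]]].
  apply (Hv H0); split; [exact Hy | split; [exact Hw |]].
  exists (/ c * d); split.
  + apply Rmult_integral_contrapositive; split; [apply Rinv_neq_0_compat |]; assumption.
  + destruct y as [z1 z2 z3 z4]; unfold scale4 in *; simpl in *.
    injection H as E1 E2 E3 E4.
    f_equal; apply (Rmult_eq_reg_l c); try assumption;
      [rewrite E1 | rewrite E2 | rewrite E3 | rewrite E4]; field; assumption.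
Qed.

Lemma dot4_same_point (n x y : vec4) :
  same_point x y -> dot4 n y = 0 -> dot4 n x = 0.
Proof.
intros [_ [_ [c [_ ->]]]] H; unfold dot4 in *; simpl.
transitivity (c * (x1 n * x1 y + x2 n * x2 y + x3 n * x3 y + x4 n * x4 y));
  [ring | rewrite H; ring].
Qed.

Lemma tangent_same_point (q : vec3 -> R) (eps : R) (x y : vec4) :
  same_point x y -> tangent_to_conic q (on_line eps y) -> tangent_to_conic q (on_line eps x).
Proof.
intros [_ [_ [c [Hc ->]]]] [p [Hp [Hq H]]].
exists p; split; [exact Hp | split; [exact Hq |]].
intros z; rewrite <- H; unfold on_line; simpl.
replace (c * x1 y * y1 z + c * x2 y * y2 z + eps' eps * (c * x3 y) * y3 z)
  with (c * (x1 y * y1 z + x2 y * y2 z + eps' eps * x3 y * y3 z)) by ring.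
split; intros [Hz E]; split; try exact Hz.
- destruct (Rmult_integral _ _ E); [contradiction | assumption].
- rewrite E; ring.
Qed.

(** * Circles of the net and the final assembly *)

Lemma touch_common_circle_of_sum (eps alpha beta a b c d : R) (xa xb xc xd : vec4) :
  alpha > beta -> beta > 0 ->
  1 + eps * alpha ^ 2 > 0 -> 1 + eps * beta ^ 2 > 0 ->
  same_point xa (v_plus eps alpha beta a) -> same_point xd (v_plus eps alpha beta d) ->
  same_point xb (v_minus eps alpha beta b) -> same_point xc (v_minus eps alpha beta c) ->
  a + d = b + c ->
  touch_common_circle eps xa xb xc xd.
Proof.
intros Hab Hb Ha' Hb' Ha Hd Hb0 Hc Hsum.
destruct (v_coplanar eps alpha beta a b c d) as [n [Hn [H1 [H2 [H3 H4]]]]]; try assumption.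
exists (fun x => oriented_line eps x /\ dot4 n x = 0); split.
- exists n; split; [exact Hn | reflexivity].
- repeat split; solve
    [ eapply oriented_line_same_point; [eassumption | apply v_oriented_line; lra]
    | eapply dot4_same_point; eassumption ].
Qed.

Theorem theorem8p9 :
  forall (eps alpha beta s s' u0l u0m : R) (l m : Z -> vec4),
  eps = -1 \/ eps = 0 \/ eps = 1 ->
  alpha > beta -> beta > 0 ->
  1 + eps * alpha ^ 2 > 0 -> 1 + eps * beta ^ 2 > 0 ->
  (forall k : Z,
     same_point (l (2 * k)%Z) (v_plus eps alpha beta (u0l + IZR k * (s + s')))) ->
  (forall k : Z,
     same_point (l (2 * k + 1)%Z) (v_minus eps alpha beta (u0l + IZR k * (s + s') + s))) ->
  (forall k : Z,
     same_point (m (2 * k)%Z) (v_minus eps alpha beta (u0m + IZR k * (s + s')))) ->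
  (forall k : Z,
     same_point (m (2 * k + 1)%Z) (v_plus eps alpha beta (u0m + IZR k * (s + s') + s))) ->
  checkerboard_incircular_net eps l m /\
  net_tangent_to_conic eps l m (ellipse alpha beta).
Proof.
intros eps alpha beta s s' u0l u0m l m Heps Hab Hb Ha' Hb' Hl0 Hl1 Hm0 Hm1.
(* Incidence with the quadric and tangency hold for every sign and every argument, so only the
   existence of some [sigma] and [u] matters for them. *)
assert (Hl : forall i, exists sigma u, sigma ^ 2 = 1 /\
  same_point (l i) (v sigma eps alpha beta u)).
{ intros i; destruct (Z.Even_or_Odd i) as [[k ->] | [k ->]].
  - exists 1; eexists; split; [ring | apply Hl0].
  - exists (-1); eexists; split; [ring | apply Hl1]. }
assert (Hm : forall j, exists sigma u, sigma ^ 2 = 1 /\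
  same_point (m j) (v sigma eps alpha beta u)).
{ intros j; destruct (Z.Even_or_Odd j) as [[k ->] | [k ->]].
  - exists (-1); eexists; split; [ring | apply Hm0].
  - exists 1; eexists; split; [ring | apply Hm1]. }
split; [split; [| split] | split].
- intros i; destruct (Hl i) as [sigma [u [Hs H]]].
  apply (oriented_line_same_point eps _ _ H), v_oriented_line; assumption.
- intros j; destruct (Hm j) as [sigma [u [Hs H]]].
  apply (oriented_line_same_point eps _ _ H), v_oriented_line; assumption.
- intros i j Hij.
  destruct (Z.Even_or_Odd i) as [[a ->] | [a ->]];
  destruct (Z.Even_or_Odd j) as [[b ->] | [b ->]];
  try (exfalso; destruct Hij as [n Hn]; lia).
  (* Both indices even: each of the two sums is u0l + u0m + (a + b)(s + s') + s. *)
  + apply (touch_common_circle_of_sum eps alpha beta _ _ _ _ _ _ _ _ Hab Hb Ha' Hb'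
      (Hl0 a) (Hm1 b) (Hl1 a) (Hm0 b)); ring.
  (* Both indices odd: the successors have even index and the signs swap within each family. Each
     sum is now u0l + u0m + (a + b + 1)(s + s') + s, and the four incidences are reordered at the
     end. *)
  + assert (Hl2 := Hl0 (a + 1)%Z); assert (Hm2 := Hm0 (b + 1)%Z).
    replace (2 * (a + 1))%Z with (2 * a + 1 + 1)%Z in Hl2 by ring.
    replace (2 * (b + 1))%Z with (2 * b + 1 + 1)%Z in Hm2 by ring.
    destruct (touch_common_circle_of_sum eps alpha beta _ _ _ _ _ _ _ _ Hab Hb Ha' Hb'
      Hl2 (Hm1 b) (Hl1 a) Hm2) as [C [HC [H1 [H2 [H3 H4]]]]];
      [rewrite !plus_IZR; ring |].
    exists C; auto.
- intros i; destruct (Hl i) as [sigma [u [Hs H]]].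
  apply (tangent_same_point _ eps _ _ H), v_tangent; assumption.
- intros j; destruct (Hm j) as [sigma [u [Hs H]]].
  apply (tangent_same_point _ eps _ _ H), v_tangent; assumption.
Qed.
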